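(* Let $(X,\perp,d)$ be a weak orthogonal metric space and let $T:X\to X$ be a self map such that $X$ is $T$-orbitally $O_w$-complete. Suppose that $T$ is weak orthogonality preserving, that $T$ is a generalized $\perp$-contraction for some $k\in[0,1)$, and that the following condition holds: whenever $x\in X$ and $\{x_n\}_{n\in\mathbb N}$ is an $O_w$-sequence in $O_T(x)$ converging to some $z\in X$, there is a subsequence $\{x_{n_j}\}_{j\in\mathbb N}$ such that for every $j\in\mathbb N$, $x_{n_j}\perp z$ or $z\perp x_{n_j}$. Then $T$ has a unique fixed point in $X$.
   Context: Weak orthogonal set: a non-empty set $X$ with a binary relation $\perp$ on $X$ for which there exists $x_0\in X$ such that for every $y\in X$, $x_0\perp y$ or $y\perp x_0$ (which alternative holds may depend on $y$). A weak orthogonal metric space ($O_w$-metric space) $(X,\perp,d)$ is a weak orthogonal set $(X,\perp)$ together with a metric $d$ on $X$. Two elements $x,y\in X$ are orthogonally related if $x\perp y$ or $y\perp x$. A sequence $\{x_n\}_{n\in\mathbb N}$ in $X$ is an $O_w$-sequence if for every $n\in\mathbb N$, $x_n\perp x_{n+1}$ or $x_{n+1}\perp x_n$. A Cauchy $O_w$-sequence is an $O_w$-sequence that is Cauchy with respect to $d$. For $T:X\to X$ and $x\in X$, the orbit of $T$ at $x$ is $O_T(x)=\{T^n x: n=0,1,2,\dots\}$. A sequence is said to be in $O_T(x)$ if all its terms belong to $O_T(x)$. $T$ is weak orthogonality preserving if for all $x,y\in X$, $x\perp y$ implies $Tx\perp Ty$ or $Ty\perp Tx$. $X$ is $T$-orbitally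 $O_w$-complete if for every $x\in X$, every Cauchy $O_w$-sequence in $O_T(x)$ converges to a point of $X$. $T$ is a generalized $\perp$-contraction (with constant $k$) if $d(Tx,Ty)\le k\,M(x,y)$ for all orthogonally related $x,y\in X$, where $$M(x,y)=\max\Big\{d(x,y),\,d(x,Tx),\,d(y,Ty),\,\tfrac{d(x,Ty)+d(Tx,y)}{2},\,\tfrac{d(T^2x,x)+d(T^2x,Ty)}{2},\,d(T^2x,Tx),\,d(T^2x,y),\,d(T^2x,Ty)\Big\}.$$ *)

(* Defs.v *)
From HB Require Import structures.
From mathcomp Require Import all_boot all_order all_algebra.
From mathcomp Require Import all_classical all_reals all_analysis.

Set Implicit Arguments.
Unset Strict Implicit.
Unset Printing Implicit Defensive.

Import Order.TTheory GRing.Theory Num.Theory.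

Local Open Scope classical_set_scope.
Local Open Scope ring_scope.

Definition orthogonally_related (X : Type) (perp : X -> X -> Prop) (x y : X) :
  Prop := perp x y \/ perp y x.

(* The witness [x0] already makes [X] non-empty. *)
Definition weak_orthogonal_set (X : Type) (perp : X -> X -> Prop) : Prop :=
  exists x0 : X, forall y : X, orthogonally_related perp x0 y.

Definition Ow_sequence (X : Type) (perp : X -> X -> Prop) (u : nat -> X) :
  Prop := forall n : nat, orthogonally_related perp (u n) (u n.+1).

Definition map_orbit (X : Type) (T : X -> X) (x : X) : set X :=
  range (fun n : nat => iter n T x).

Definition sequence_in (X : Type) (A : set X) (u : nat -> X) : Prop :=
  forall n : nat, A (u n).

Definition weak_orthogonality_preserving (X : Type) (perp : X -> X -> Prop)
    (T : X -> X) : Prop :=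
  forall x y : X, perp x y -> orthogonally_related perp (T x) (T y).

Definition orbitally_Ow_complete (R : realType) (X : metricType R)
    (perp : X -> X -> Prop) (T : X -> X) : Prop :=
  forall (x : X) (u : nat -> X),
    sequence_in (map_orbit T x) u -> Ow_sequence perp u -> cauchy (u @ \oo) ->
    exists z : X, u @ \oo --> z.

Definition contraction_max (R : realType) (X : metricType R) (T : X -> X)
    (x y : X) : R :=
  Num.max (mdist x y)
  (Num.max (mdist x (T x))
  (Num.max (mdist y (T y))
  (Num.max ((mdist x (T y) + mdist (T x) y) / 2)
  (Num.max ((mdist (T (T x)) x + mdist (T (T x)) (T y)) / 2)
  (Num.max (mdist (T (T x)) (T x))
  (Num.max (mdist (T (T x)) y)
           (mdist (T (T x)) (T y)))))))).

Definition generalized_perp_contraction (R : realType) (X : metricType R)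
    (perp : X -> X -> Prop) (T : X -> X) (k : R) : Prop :=
  forall x y : X, orthogonally_related perp x y ->
    mdist (T x) (T y) <= k * contraction_max T x y.

Definition orbital_limit_condition (R : realType) (X : metricType R)
    (perp : X -> X -> Prop) (T : X -> X) : Prop :=
  forall (x z : X) (u : nat -> X),
    sequence_in (map_orbit T x) u -> Ow_sequence perp u -> u @ \oo --> z ->
    exists2 f : nat -> nat, increasing_seq f &
      forall j : nat, orthogonally_related perp (u (f j)) z.

(* Main.v *)
Require Import Defs.
From mathcomp Require Import all_boot all_order all_algebra.
From mathcomp Require Import all_classical all_reals all_analysis.
From mathcomp Require Import lra.

Import Order.TTheory GRing.Theory Num.Theory.

Local Open Scope classical_set_scope.
Local Open Scope ring_scope.

(** The fixed point is the limit of the Picard iterates [iter n T x0] of the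
    point [x0] that is related to every point of the space.

    Since [T] preserves the symmetric relation, consecutive iterates of [x0] are
    related.  For [y = T x] the eight distances in the contraction bound collapse
    to [d(x, Tx)] and [d(Tx, TTx)], and as [k < 1] the second cannot be the
    larger one; hence [d(Tx, TTx) <= k d(x, Tx)]
    ([perp_contraction_consecutive]).  The iterates are therefore Cauchy
    ([geometric_steps_cauchy]), and orbital completeness gives a limit [z].

    Fixedness and uniqueness both follow from [perp_contraction_orbit_limit].
    Let [w] be related to iterates of arbitrarily large index, and suppose that
    [d(z, w)] and [d(w, Tw)] are at most [D = d(z, Tw)].  Letting the index grow
    in the contraction bound for an iterate and [w] gives [D <= k D], so
    [z = Tw].  The limit condition provides the related iterates for [w = z],
    and [d(z, z)] and [d(z, Tz)] are trivially at most [d(z, Tz)], so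
    [z = Tz].  A fixed point [w] is related to [x0], hence to every
    iterate, because [T] maps the pair [(iter n T x0, w)] to
    [(iter n.+1 T x0, w)]; now [d(z, w)] and [d(w, Tw) = 0] are at most
    [d(z, Tw) = d(z, w)], so [w = z]. *)

Lemma orthogonally_related_iter (X : Type) (perp : X -> X -> Prop) (T : X -> X)
    (x y : X) (n : nat) :
  weak_orthogonality_preserving perp T -> orthogonally_related perp x y ->
  orthogonally_related perp (iter n T x) (iter n T y).
Proof.
move=> hpres xy; elim: n => //= n [/hpres//|/hpres].
by rewrite /orthogonally_related; tauto.
Qed.

Lemma increasing_seq_ge_id (f : nat -> nat) (n : nat) :
  increasing_seq f -> (n <= f n)%N.
Proof.
move=> fI; elim: n => // n /leq_ltn_trans; apply.
by have := leW_mono fI n n.+1; rewrite !ltEnat /= ltnSn.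
Qed.

(** Over the first step the bound [a/(1-k)] for the distance from [u n] to later
    terms reproduces itself, [a + k a/(1-k) = a/(1-k)], so induction on the
    number of steps replaces the summation of a geometric series. *)
Lemma geometric_steps_tail (R : realType) (X : metricType R) (k : R)
    (u : nat -> X) (m n : nat) :
  0 <= k -> k < 1 ->
  (forall i, mdist (u i.+1) (u i.+2) <= k * mdist (u i) (u i.+1)) ->
  mdist (u n) (u (n + m)%N) <= mdist (u n) (u n.+1) / (1 - k).
Proof.
move=> k0 k1 hu; have k1' : 0 < 1 - k by rewrite subr_gt0.
elim: m n => [|m IH] n.
  by rewrite addn0 mdistxx divr_ge0 ?mdist_ge0 // ltW.
apply: le_trans (metric_triangle _ (u n.+1) _) _.
rewrite -addSnnS ler_pdivlMr // mulrDl.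
have := IH n.+1; rewrite ler_pdivlMr // => {}IH.
by have := hu n; lra.
Qed.

Lemma geometric_steps_cauchy (R : realType) (X : metricType R) (k : R)
    (u : nat -> X) :
  0 <= k -> k < 1 ->
  (forall i, mdist (u i.+1) (u i.+2) <= k * mdist (u i) (u i.+1)) ->
  cauchy (u @ \oo).
Proof.
move=> k0 k1 hu; have k1' : 0 < 1 - k by rewrite subr_gt0.
have stepE n : mdist (u n) (u n.+1) <= k ^+ n * mdist (u 0%N) (u 1%N).
  elim: n => [|n IH]; first by rewrite expr0 mul1r.
  by apply: le_trans (hu n) _; rewrite exprS -mulrA ler_wpM2l.
apply: cauchy_exP => e e0.
set a := mdist (u 0%N) (u 1%N) in stepE.
have a0 : 0 <= a := mdist_ge0 _ _.
(* [a + 1] rather than [a] keeps the threshold positive when the first step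
   is zero. *)
have d0 : 0 < e * (1 - k) / (a + 1) by rewrite divr_gt0 ?mulr_gt0 //; lra.
have [N _ hN] : \forall n \near \oo, k ^+ n < e * (1 - k) / (a + 1).
  have kn : `|k| < 1 by rewrite ger0_norm.
  have /cvgr0Pnorm_lt/(_ _ d0) := cvg_expr kn.
  apply: filterS => n /=.
  by rewrite ger0_norm // exprn_ge0.
have hNN := hN N (leqnn N); rewrite /= ltr_pdivlMr in hNN; last lra.
exists (u N), N => // n /= Nn; rewrite ballEmdist /= -(subnKC Nn).
apply: le_lt_trans (geometric_steps_tail _ _ _ _ _ _ k0 k1 hu) _.
rewrite ltr_pdivrMr //; apply: le_lt_trans (stepE N) _.
by have := exprn_ge0 N k0; lra.
Qed.

Lemma contraction_max_le (R : realType) (X : metricType R) (T : X -> X)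
    (x y : X) (c : R) :
  mdist x y <= c -> mdist x (T x) <= c -> mdist y (T y) <= c ->
  (mdist x (T y) + mdist (T x) y) / 2 <= c ->
  (mdist (T (T x)) x + mdist (T (T x)) (T y)) / 2 <= c ->
  mdist (T (T x)) (T x) <= c -> mdist (T (T x)) y <= c ->
  mdist (T (T x)) (T y) <= c ->
  contraction_max T x y <= c.
Proof. by rewrite /contraction_max !ge_max => -> -> -> -> -> -> -> ->. Qed.

(** Write [a = d(x, Tx)] and [b = d(Tx, TTx)].  Both averages are at most
    [(a + b) / 2] by the triangle inequality, so the contraction bound is at most
    [k max(a, b)]; the case [a < b] is absurd, since [b <= k b] forces [b = 0]. *)
Lemma perp_contraction_consecutive (R : realType) (X : metricType R)
    (perp : X -> X -> Prop) (T : X -> X) (k : R) (x : X) :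
  0 <= k -> k < 1 -> generalized_perp_contraction perp T k ->
  orthogonally_related perp x (T x) ->
  mdist (T x) (T (T x)) <= k * mdist x (T x).
Proof.
move=> k0 k1 hcontr /hcontr.
set a := mdist x (T x); set b := mdist (T x) (T (T x)) => hb.
have a0 : 0 <= a := mdist_ge0 _ _.
have b0 : 0 <= b := mdist_ge0 _ _.
have xTT : mdist x (T (T x)) <= a + b := metric_triangle _ _ _.
have hM : contraction_max T x (T x) <= Num.max a b.
  have aM : a <= Num.max a b by rewrite le_max lexx.
  have bM : b <= Num.max a b by rewrite le_max lexx orbT.
  apply: contraction_max_le; rewrite ?mdistxx ?(metric_sym (T (T x))) //;
    by rewrite -/a -/b; lra.
have {hb}hM := le_trans hb (ler_wpM2l k0 hM).
have [ba|ab] := leP b a; first by rewrite (max_idPl ba) in hM.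
by rewrite (max_idPr (ltW ab)) in hM; nra.
Qed.

(** With [D = d(z, Tw)] and a late iterate [y] satisfying [d(z, y) <= e] and
    [d(z, Ty), d(z, TTy) <= e], every entry of the contraction bound for [y] and
    [w] is at most [D + 2 e], so [D <= e + k (D + 2 e)].  This contradicts
    [D > 0] once [e] is small compared with [(1 - k) D]. *)
Lemma perp_contraction_orbit_limit (R : realType) (X : metricType R)
    (perp : X -> X -> Prop) (T : X -> X) (k : R) (x z w : X) :
  0 <= k -> k < 1 -> generalized_perp_contraction perp T k ->
  iter n T x @[n --> \oo] --> z ->
  (forall N, exists2 n, (N <= n)%N & orthogonally_related perp (iter n T x) w) ->
  mdist z w <= mdist z (T w) -> mdist w (T w) <= mdist z (T w) ->
  z = T w.
Proof.
move=> k0 k1 hcontr xz hrel; set D := mdist z (T w) => zwD wTwD.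
apply: mdist_positivity; rewrite -/D.
have [D0|//|->//] := ltgtP D 0; first by have := mdist_ge0 z (T w); rewrite -/D; lra.
move=> D0; exfalso; pose e := (1 - k) * D / 4.
have e0 : 0 < e by rewrite /e; nra.
have [N _ hN] := metricType_numDomainType.cvgr_dist_le xz e0.
have [n Nn /hcontr] := hrel N.
have := hN n Nn; have := hN n.+1 (leqW Nn); have := hN n.+2 (leqW (leqW Nn)).
rewrite /=; set y := iter n T x => zTTy zTy zy yw.
have tri p q : mdist p q <= mdist z p + mdist z q.
  by rewrite (metric_sym z p) metric_triangle.
have hM : contraction_max T y w <= D + 2 * e.
  have ? := tri y w; have ? := tri y (T y); have ? := tri y (T w).
  have ? := tri (T y) w; have ? := tri (T (T y)) y.
  have ? := tri (T (T y)) (T w); have ? := tri (T (T y)) (T y).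
  have ? := tri (T (T y)) w.
  have zTw : mdist z (T w) <= D by [].
  by apply: contraction_max_le; lra.
have {hM}yw := le_trans yw (ler_wpM2l k0 hM).
have := metric_triangle z (T y) (T w); rewrite -/D.
(* [3 e < (1 - k) D] by the choice of [e], and [2 k e <= 2 e]. *)
have ke : k * e <= e by nra.
by move: yw ke zTy D0; rewrite /e; nra.
Qed.

Theorem theorem2p3 (R : realType) (X : metricType R) (perp : X -> X -> Prop)
  (T : X -> X) (k : R)
  (hX : weak_orthogonal_set perp)
  (hcomplete : orbitally_Ow_complete perp T)
  (hpres : weak_orthogonality_preserving perp T)
  (hk0 : 0 <= k) (hk1 : k < 1)
  (hcontr : generalized_perp_contraction perp T k)
  (hlim : orbital_limit_condition perp T) :
  exists! z : X, T z = z.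
Proof.
have [x0 hx0] := hX; pose u n := iter n T x0.
have u_Ow : Ow_sequence perp u.
  move=> n; rewrite /u iterSr; exact: orthogonally_related_iter.
have u_in : sequence_in (map_orbit T x0) u by move=> n; exists n.
have u_cauchy : cauchy (u @ \oo).
  apply: (geometric_steps_cauchy _ _ k) => // n.
  exact: (perp_contraction_consecutive _ _ perp T k (u n) hk0 hk1 hcontr (u_Ow n)).
have [z uz] := hcomplete _ _ u_in u_Ow u_cauchy.
have limit_eq := perp_contraction_orbit_limit _ _ _ _ _ _ _ _ hk0 hk1 hcontr uz.
exists z; split.
  have [f fI hf] := hlim _ _ _ u_in u_Ow uz.
  apply/esym/limit_eq; rewrite ?mdistxx ?mdist_ge0 //.
  by move=> N; exists (f N); [exact: increasing_seq_ge_id | exact: hf].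
move=> w wfix; rewrite -wfix; apply: limit_eq; rewrite ?wfix ?mdistxx ?mdist_ge0 //.
move=> N; exists N => //.
by rewrite -(iter_fix N wfix); exact: orthogonally_related_iter.
Qed.
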